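(* The system $\mathsf{DG}$ proves $\mathsf{WKL}^{\mathrm{st}}$ and $\mathsf{UWKL}^{\mathrm{st}}$, where $\mathsf{WKL}$ is $(\forall T^1\le 1)\big[(\forall n^0)(\exists\beta\le_1 1)(\overline{\beta}n\in T)\rightarrow(\exists\alpha\le_1 1)(\forall m^0)(\overline{\alpha}m\in T)\big]$, $\mathsf{UWKL}$ is $(\exists\Psi^{1\to1})(\forall T^1\le 1)\big[(\forall n^0)(\exists\beta\le_1 1)(\overline{\beta}n\in T)\rightarrow(\forall m^0)(\overline{\Psi(T)}m\in T)\big]$, and for an internal statement $A$, $A^{\mathrm{st}}$ denotes $A$ with all quantifiers (except bounded number quantifiers) relativised to $\mathrm{st}$.
   Context: The variable $T^1$ ranges over (codes of) trees, i.e. characteristic functions of sets of (codes of) finite sequences closed under initial segments; $T\le_1 1$ means $T$ is a binary tree; $\overline{\alpha}m=\langle\alpha(0),\dots,\alpha(m-1)\rangle$. Finite types: $0$ is a type and if $\rho,\sigma$ are types so is $\rho\to\sigma$; type $1=0\to0$, $2=1\to0$. $\mathsf{E\text{-}HA}^{\omega}$ is Heyting arithmetic in all finite types (intuitionistic logic, Gödel's $T$ constants) with extensionality. Equality $=_0$ is primitive; for $\tau=\tau_1\to\dots\to\tau_k\to0$, $x=_\tau y$ abbreviates $(\forall z_1\dots z_k)(xz_1\dots z_k=_0yz_1\dots z_k)$, and $\le_\tau$ likewise. Extensionality $(\mathsf E_{\rho\to\tau})$: $(\forall\varphi)(\forall x,y)(x=_\rho y\to\varphi(x)=_\tau\varphi(y))$,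 for all types. Strong majorizability (Howard–Bezem): $x\le^*_0 y$ iff $x\le_0 y$; $x\le^*_{\rho\to\sigma}y$ iff for all $u,v$ with $u\le^*_\rho v$: $xu\le^*_\sigma yv$ and $yu\le^*_\sigma yv$. Monotone: $x\le^*x$; $\tilde\forall,\tilde\exists$ range over monotone objects. The language of $\mathsf{DG}$ adds predicates $\mathrm{st}^\sigma$ (''is standard''); $\forall^{\mathrm{st}},\exists^{\mathrm{st}}$ are the relativised quantifiers, $\tilde\forall^{\mathrm{st}},\tilde\exists^{\mathrm{st}}$ combine both restrictions. Internal = not containing $\mathrm{st}$. $\mathsf{DG}$ is $\mathsf{E\text{-}HA}^\omega$ in the extended language plus: (a) $x=_\sigma y\to(\mathrm{st}(x)\to\mathrm{st}(y))$; (b) $\mathrm{st}(y)\to(x\le^*_\sigma y\to\mathrm{st}(x))$; (c) $\mathrm{st}(t)$ for closed terms $t$; (d) $\mathrm{st}(z)\to(\mathrm{st}(x)\to\mathrm{st}(zx))$; external induction $\Phi(0)\wedge(\forall^{\mathrm{st}}n)(\Phi(n)\to\Phi(n+1))\to(\forall^{\mathrm{st}}n)\Phi(n)$ for any $\Phi$; and for arbitrary $\Phi,\Psi$ and internal $\phi,\psi$: $\mathsf{mAC}^\omega$: $(\tilde\forall^{\mathrm{st}}x)(\tilde\exists^{\mathrm{st}}y)\Phi(x,y)\to(\tilde\exists^{\mathrm{st}}f)(\tilde\forall^{\mathrm{st}}x)(\exists y\le^*f(x))\Phi(x,y)$; $\mathsf R^\omega$: $(\forall x)(\exists^{\mathrm{st}}y)\Phi(x,y)\to(\tilde\exists^{\mathrm{st}}z)(\forall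 x)(\exists y\le^*z)\Phi(x,y)$; $\mathsf I^\omega$: $(\tilde\forall^{\mathrm{st}}z)(\exists x)(\forall y\le^*z)\phi(x,y)\to(\exists x)(\forall^{\mathrm{st}}y)\phi(x,y)$; $\mathsf{IP}^\omega_{\tilde\forall^{\mathrm{st}}}$: $[(\tilde\forall^{\mathrm{st}}x)\phi(x)\to(\tilde\exists^{\mathrm{st}}y)\Psi(y)]\to(\tilde\exists^{\mathrm{st}}z)[(\tilde\forall^{\mathrm{st}}x)\phi(x)\to(\tilde\exists y\le^*z)\Psi(y)]$; $\mathsf M^\omega$: $[(\tilde\forall^{\mathrm{st}}x)\phi(x)\to\psi]\to(\tilde\exists^{\mathrm{st}}y)[(\forall x\le^*y)\phi(x)\to\psi]$; $\mathsf{MAJ}^\omega$: $(\forall^{\mathrm{st}}x)(\exists^{\mathrm{st}}y)(x\le^*y)$. *)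

(* Defs.v *)
From Stdlib Require Import List.
Import ListNotations.

Set Implicit Arguments.
Unset Strict Implicit.
Unset Printing Implicit Defensive.

(** * Syntax: finite types, Goedel's T (with combinators), formulas *)

Inductive ty : Set :=
| N : ty
| Arr : ty -> ty -> ty.

Declare Scope ty_scope.
Delimit Scope ty_scope with ty.
Bind Scope ty_scope with ty.
Infix "~>" := Arr (at level 55, right associativity) : ty_scope.
Local Open Scope ty_scope.

Definition cx := list ty.

Inductive const : ty -> Set :=
| cZ : const N
| cS : const (N ~> N)
| cPi (r s : ty) : const (r ~> s ~> r)
| cSig (d r s : ty) : const ((d ~> r ~> s) ~> (d ~> r) ~> d ~> s)
| cRec (r : ty) : const (N ~> r ~> (r ~> N ~> r) ~> r).

(* Terms and formulas are intrinsically typed, with de Bruijn variables: the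
   context [G] lists the types of the free variables. *)
Inductive var : cx -> ty -> Set :=
| VZ (G : cx) (s : ty) : var (s :: G) s
| VS (G : cx) (s r : ty) : var G s -> var (r :: G) s.

Arguments VZ {G s}.
Arguments VS {G s r} _.

Inductive tm (G : cx) : ty -> Set :=
| Var (s : ty) : var G s -> tm G s
| Cst (s : ty) : const s -> tm G s
| App (r s : ty) : tm G (r ~> s) -> tm G r -> tm G s.

Arguments Var {G s} _.
Arguments Cst {G s} _.
Arguments App {G r s} _ _.

Inductive fm : cx -> Set :=
| Bot (G : cx) : fm G
| Eq0 (G : cx) : tm G N -> tm G N -> fm G
| St (G : cx) (s : ty) : tm G s -> fm G
| And (G : cx) : fm G -> fm G -> fm G
| Or (G : cx) : fm G -> fm G -> fm G
| Imp (G : cx) : fm G -> fm G -> fm G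
| All (G : cx) (s : ty) : fm (s :: G) -> fm G
| Ex (G : cx) (s : ty) : fm (s :: G) -> fm G.

Arguments Bot {G}.
Arguments Eq0 {G} _ _.
Arguments St {G s} _.
Arguments And {G} _ _.
Arguments Or {G} _ _.
Arguments Imp {G} _ _.
Arguments All {G} s _.
Arguments Ex {G} s _.

Declare Scope fm_scope.
Delimit Scope fm_scope with fm.
Bind Scope fm_scope with fm.
Declare Scope tm_scope.
Delimit Scope tm_scope with tm.
Bind Scope tm_scope with tm.
Infix "@" := App (at level 40, left associativity) : tm_scope.
Infix "=0" := Eq0 (at level 70, no associativity) : fm_scope.
Infix "&&&" := And (at level 76, right associativity) : fm_scope.
Infix "|||" := Or (at level 77, right associativity) : fm_scope.
Infix "==>" := Imp (at level 78, right associativity) : fm_scope.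
Local Open Scope tm_scope.
Local Open Scope fm_scope.

Fixpoint internal {G} (A : fm G) : Prop :=
  match A with
  | Bot => True
  | Eq0 _ _ => True
  | St _ => False
  | And B C | Or B C | Imp B C => internal B /\ internal C
  | All _ B | Ex _ B => internal B
  end.

(** * Renaming and substitution *)

Definition ren (G D : cx) := forall s, var G s -> var D s.
Definition sub (G D : cx) := forall s, var G s -> tm D s.

Definition up_ren {G D} (r : ty) (f : ren G D) : ren (r :: G) (r :: D) :=
  fun s v =>
    match v in var G' s' return
      match G' with
      | [] => unit
      | q :: G0 => ren G0 D -> var (q :: D) s'
      end
    with
    | VZ => fun _ => VZ
    | VS w => fun g => VS (g _ w)
    end f.

Fixpoint ren_tm {G D} (f : ren G D) {s} (t : tm G s) : tm D s :=
  match t with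
  | Var v => Var (f _ v)
  | Cst c => Cst c
  | App t u => ren_tm f t @ ren_tm f u
  end.

Fixpoint ren_fm {G} (A : fm G) : forall {D}, ren G D -> fm D :=
  match A with
  | Bot => fun _ _ => Bot
  | Eq0 t u => fun _ f => ren_tm f t =0 ren_tm f u
  | St t => fun _ f => St (ren_tm f t)
  | And B C => fun _ f => ren_fm B f &&& ren_fm C f
  | Or B C => fun _ f => ren_fm B f ||| ren_fm C f
  | Imp B C => fun _ f => ren_fm B f ==> ren_fm C f
  | All s B => fun _ f => All s (ren_fm B (up_ren f))
  | Ex s B => fun _ f => Ex s (ren_fm B (up_ren f))
  end.

Definition shift {G} {r : ty} : ren G (r :: G) := fun _ v => VS v.
Definition wk {G r s} (t : tm G s) : tm (r :: G) s := ren_tm shift t.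
Definition wkf {G r} (A : fm G) : fm (r :: G) := ren_fm A shift.

Definition scons {G D r} (t : tm D r) (f : sub G D) : sub (r :: G) D :=
  fun s v =>
    match v in var G' s' return
      match G' with
      | [] => unit
      | q :: G0 => tm D q -> sub G0 D -> tm D s'
      end
    with
    | VZ => fun t _ => t
    | VS w => fun _ g => g _ w
    end t f.

Definition up_sub {G D} (r : ty) (f : sub G D) : sub (r :: G) (r :: D) :=
  scons (Var VZ) (fun s v => wk (f s v)).

Fixpoint sub_tm {G D} (f : sub G D) {s} (t : tm G s) : tm D s :=
  match t with
  | Var v => f _ v
  | Cst c => Cst c
  | App t u => sub_tm f t @ sub_tm f u
  end.

Fixpoint sub_fm {G} (A : fm G) : forall {D}, sub G D -> fm D :=
  match A with
  | Bot => fun _ _ => Bot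
  | Eq0 t u => fun _ f => sub_tm f t =0 sub_tm f u
  | St t => fun _ f => St (sub_tm f t)
  | And B C => fun _ f => sub_fm B f &&& sub_fm C f
  | Or B C => fun _ f => sub_fm B f ||| sub_fm C f
  | Imp B C => fun _ f => sub_fm B f ==> sub_fm C f
  | All s B => fun _ f => All s (sub_fm B (up_sub f))
  | Ex s B => fun _ f => Ex s (sub_fm B (up_sub f))
  end.

Definition inst {G r} (A : fm (r :: G)) (t : tm G r) : fm G :=
  sub_fm A (scons t (fun s v => Var v)).

Definition closed_tm {G s} (t : tm [] s) : tm G s :=
  ren_tm
    (fun r (v : var [] r) =>
       match v in var G' r' return
         match G' with [] => var G r' | _ :: _ => unit end
       with VZ => tt | VS _ => tt end) t.

Definition v0 {G s} : tm (s :: G) s := Var VZ.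
Definition v1 {G s r} : tm (r :: s :: G) s := Var (VS VZ).
Definition v2 {G s r q} : tm (q :: r :: s :: G) s := Var (VS (VS VZ)).

(* Bracket abstraction: the language has no binder at the level of terms, and
   [lam t] is the usual combinatory term with [lam t @ u] = [t(u)]. *)
Fixpoint lam {G r s} (t : tm (r :: G) s) : tm G (r ~> s) :=
  match t with
  | Var v =>
      match v in var G' s' return
        match G' with [] => unit | q :: G0 => tm G0 (q ~> s') end
      with
      | @VZ G0 q => Cst (cSig q (q ~> q) q) @ Cst (cPi q (q ~> q)) @ Cst (cPi q q)
      | VS w => Cst (cPi _ _) @ Var w
      end
  | Cst c => Cst (cPi _ _) @ Cst c
  | App t u => Cst (cSig _ _ _) @ lam t @ lam u
  end.

(** * Arithmetic terms *)

Definition Z {G} : tm G N := Cst cZ.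
Definition Sc {G} (n : tm G N) : tm G N := Cst cS @ n.
Definition rec_ {G r} (n : tm G N) (a : tm G r) (f : tm G (r ~> N ~> r)) : tm G r :=
  Cst (cRec r) @ n @ a @ f.

Definition pred_ {G} (n : tm G N) : tm G N := rec_ n Z (lam (lam v0)).
Definition add_ {G} (n m : tm G N) : tm G N := rec_ m n (lam (lam (Sc v1))).
Definition monus {G} (n m : tm G N) : tm G N := rec_ m n (lam (lam (pred_ v1))).

(* tri n = 0 + 1 + ... + n *)
Definition tri {G} (n : tm G N) : tm G N := rec_ n Z (lam (lam (add_ v1 (Sc v0)))).
(* Cantor's bijection from pairs onto numbers. *)
Definition pair_ {G} (n m : tm G N) : tm G N := add_ (tri (add_ n m)) m.

(* Codes of finite sequences: 0 codes the empty one, and if s codes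
   <x_0,...,x_{k-1}> then [snoc s x] codes <x_0,...,x_{k-1},x>.  Every number
   is the code of exactly one finite sequence. *)
Definition snoc {G} (s x : tm G N) : tm G N := Sc (pair_ s x).

(* The code of <a 0, ..., a (n-1)>. *)
Definition bar {G} (a : tm G (N ~> N)) (n : tm G N) : tm G N :=
  rec_ n Z (lam (lam (snoc v1 (wk (wk a) @ v0)))).

Definition one1 {G} : tm G (N ~> N) := Cst (cPi N N) @ Sc Z.

(** * Defined relations *)

Definition le0 {G} (x y : tm G N) : fm G := monus x y =0 Z.

Fixpoint eqT {s : ty} {G : cx} : tm G s -> tm G s -> fm G :=
  match s with
  | N => fun x y => x =0 y
  | Arr r q => fun x y => All r (eqT (wk x @ v0) (wk y @ v0))
  end.

Fixpoint leT {s : ty} {G : cx} : tm G s -> tm G s -> fm G :=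
  match s with
  | N => fun x y => le0 x y
  | Arr r q => fun x y => All r (leT (wk x @ v0) (wk y @ v0))
  end.

(* Strong majorizability; in the step, u is [v1] and v is [v0]. *)
Fixpoint maj {s : ty} {G : cx} : tm G s -> tm G s -> fm G :=
  match s with
  | N => fun x y => le0 x y
  | Arr r q => fun x y =>
      All r (All r (maj v1 v0 ==>
        (maj (wk (wk x) @ v1) (wk (wk y) @ v0) &&&
         maj (wk (wk y) @ v1) (wk (wk y) @ v0))))
  end.

Definition mono {G s} (x : tm G s) : fm G := maj x x.

Definition all_st {G} (s : ty) (A : fm (s :: G)) : fm G := All s (St v0 ==> A).
Definition ex_st {G} (s : ty) (A : fm (s :: G)) : fm G := Ex s (St v0 &&& A).
Definition tall_st {G} (s : ty) (A : fm (s :: G)) : fm G :=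
  All s (St v0 &&& mono v0 ==> A).
Definition tex_st {G} (s : ty) (A : fm (s :: G)) : fm G :=
  Ex s ((St v0 &&& mono v0) &&& A).
Definition all_maj {G} (s : ty) (b : tm G s) (A : fm (s :: G)) : fm G :=
  All s (maj v0 (wk b) ==> A).
Definition ex_maj {G} (s : ty) (b : tm G s) (A : fm (s :: G)) : fm G :=
  Ex s (maj v0 (wk b) &&& A).
Definition tex_maj {G} (s : ty) (b : tm G s) (A : fm (s :: G)) : fm G :=
  Ex s (mono v0 &&& maj v0 (wk b) &&& A).

(** * The axioms *)

(* Insert a fresh variable just below the innermost one (resp. two). *)
Definition wk1 {G p q} (A : fm (q :: G)) : fm (q :: p :: G) :=
  ren_fm A (up_ren shift).
Definition wk2 {G p q r} (A : fm (r :: q :: G)) : fm (r :: q :: p :: G) :=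
  ren_fm A (up_ren (up_ren shift)).

(* Non-logical axioms of E-HA^omega.  Free variables are parameters, so each
   clause stands for its universal closure. *)
Inductive EHA : forall {G}, fm G -> Prop :=
| EHA_refl G (x : tm G N) : EHA (x =0 x)
| EHA_sym G (x y : tm G N) : EHA (x =0 y ==> y =0 x)
| EHA_trans G (x y z : tm G N) : EHA (x =0 y ==> y =0 z ==> x =0 z)
| EHA_S_inj G (x y : tm G N) : EHA (Sc x =0 Sc y ==> x =0 y)
| EHA_S_nz G (x : tm G N) : EHA (Sc x =0 Z ==> Bot)
| EHA_induction G (A : fm (N :: G)) : internal A ->
    EHA (inst A Z &&& All N (A ==> sub_fm A (scons (Sc v0) (fun s v => Var (VS v))))
         ==> All N A)
| EHA_Pi G r s (x : tm G r) (y : tm G s) :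
    EHA (eqT (Cst (cPi r s) @ x @ y) x)
| EHA_Sig G d r s (x : tm G (d ~> r ~> s)) (y : tm G (d ~> r)) (z : tm G d) :
    EHA (eqT (Cst (cSig d r s) @ x @ y @ z) (x @ z @ (y @ z)))
| EHA_Rec0 G r (y : tm G r) (z : tm G (r ~> N ~> r)) :
    EHA (eqT (rec_ Z y z) y)
| EHA_RecS G r (x : tm G N) (y : tm G r) (z : tm G (r ~> N ~> r)) :
    EHA (eqT (rec_ (Sc x) y z) (z @ rec_ x y z @ x))
| EHA_ext G r s (f : tm G (r ~> s)) (x y : tm G r) :
    EHA (eqT x y ==> eqT (f @ x) (f @ y)).

Inductive DGax : forall {G}, fm G -> Prop :=
| DG_EHA G (A : fm G) : EHA A -> DGax A
| DG_st_eq G s (x y : tm G s) : DGax (eqT x y ==> St x ==> St y)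
| DG_st_maj G s (x y : tm G s) : DGax (St y ==> maj x y ==> St x)
| DG_st_closed G s (t : tm [] s) : DGax (St (closed_tm (G := G) t))
| DG_st_app G r s (z : tm G (r ~> s)) (x : tm G r) :
    DGax (St z ==> St x ==> St (z @ x))
| DG_ext_ind G (P : fm (N :: G)) :
    DGax (inst P Z &&&
          all_st (P ==> sub_fm P (scons (Sc v0) (fun s v => Var (VS v))))
          ==> all_st P)
(* In [P : fm (t :: s :: G)] the variable x has index 1 and y index 0. *)
| DG_mAC G s t (P : fm (t :: s :: G)) :
    DGax (tall_st (tex_st P) ==>
          tex_st (s := s ~> t) (tall_st (s := s) (ex_maj (v1 @ v0) (wk2 P))))
| DG_R G s t (P : fm (t :: s :: G)) :
    DGax (All s (ex_st P) ==>
          tex_st (s := t) (All s (ex_maj v1 (wk2 P))))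
| DG_I G s t (A : fm (t :: s :: G)) : internal A ->
    DGax (tall_st (s := t) (Ex s (all_maj v1 (wk2 A))) ==>
          Ex s (all_st A))
| DG_IP G s t (A : fm (s :: G)) (Q : fm (t :: G)) : internal A ->
    DGax ((tall_st A ==> tex_st Q) ==>
          tex_st (s := t) (tall_st (wk1 A) ==> tex_maj v0 (wk1 Q)))
| DG_M G s (A : fm (s :: G)) (B : fm G) : internal A -> internal B ->
    DGax ((tall_st A ==> B) ==>
          tex_st (s := s) (all_maj v0 (wk1 A) ==> wkf B))
| DG_MAJ G s : DGax (G := G) (all_st (ex_st (maj (s := s) v1 v0))).

(** * Derivability: intuitionistic natural deduction over [DGax] *)

Inductive prf : forall {G}, list (fm G) -> fm G -> Prop :=
| prf_hyp G (H : list (fm G)) A : In A H -> prf H A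
| prf_ax G (H : list (fm G)) A : DGax A -> prf H A
| prf_botE G (H : list (fm G)) A : prf H Bot -> prf H A
| prf_andI G (H : list (fm G)) A B : prf H A -> prf H B -> prf H (A &&& B)
| prf_andE1 G (H : list (fm G)) A B : prf H (A &&& B) -> prf H A
| prf_andE2 G (H : list (fm G)) A B : prf H (A &&& B) -> prf H B
| prf_orI1 G (H : list (fm G)) A B : prf H A -> prf H (A ||| B)
| prf_orI2 G (H : list (fm G)) A B : prf H B -> prf H (A ||| B)
| prf_orE G (H : list (fm G)) A B C :
    prf H (A ||| B) -> prf (A :: H) C -> prf (B :: H) C -> prf H C
| prf_impI G (H : list (fm G)) A B : prf (A :: H) B -> prf H (A ==> B)
| prf_impE G (H : list (fm G)) A B : prf H (A ==> B) -> prf H A -> prf H B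
| prf_allI G (H : list (fm G)) s (A : fm (s :: G)) :
    prf (map wkf H) A -> prf H (All s A)
| prf_allE G (H : list (fm G)) s (A : fm (s :: G)) t :
    prf H (All s A) -> prf H (inst A t)
| prf_exI G (H : list (fm G)) s (A : fm (s :: G)) t :
    prf H (inst A t) -> prf H (Ex s A)
| prf_exE G (H : list (fm G)) s (A : fm (s :: G)) B :
    prf H (Ex s A) -> prf (A :: map wkf H) (wkf B) -> prf H B.

Definition DG_proves (A : fm []) : Prop := prf [] A.

(** * Weak Koenig's lemma *)

(* A^st.  This relativises every quantifier; none of the formulas it is applied
   to below contains a bounded number quantifier (<=_0 is quantifier-free). *)
Fixpoint rel {G} (A : fm G) : fm G :=
  match A with
  | Bot => Bot
  | Eq0 t u => t =0 u
  | St t => St t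
  | And B C => rel B &&& rel C
  | Or B C => rel B ||| rel C
  | Imp B C => rel B ==> rel C
  | All s B => all_st (rel B)
  | Ex s B => ex_st (rel B)
  end.

(* [inT s T]: T takes the value 1 at (the code) s. *)
Definition inT {G} (s : tm G N) (T : tm G (N ~> N)) : fm G := T @ s =0 Sc Z.

(* The finite sequence s is an initial segment of t:
   s = <a 0,...,a(n-1)> and t = <a 0,...,a(n+k-1)> for some a, n, k. *)
Definition init_seg {G} (s t : tm G N) : fm G :=
  Ex (N ~> N) (Ex N (Ex N
    (wk (wk (wk s)) =0 bar v2 v1 &&& wk (wk (wk t)) =0 bar v2 (add_ v1 v0)))).

Definition bin_seq {G} (s : tm G N) : fm G :=
  Ex (N ~> N) (leT v0 one1 &&& Ex N (wk (wk s) =0 bar v1 v0)).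

(* T is the characteristic function of a set of codes of finite sequences which
   is closed under initial segments and consists of 0-1-sequences. *)
Definition binary_tree {G} (T : tm G (N ~> N)) : fm G :=
  leT T one1 &&&
  All N (All N (init_seg v1 v0 ==> inT v0 (wk (wk T)) ==> inT v1 (wk (wk T)))) &&&
  All N (inT v0 (wk T) ==> bin_seq v0).

(* (forall n)(exists b <=_1 1)(bar b n in T) *)
Definition infinite {G} (T : tm G (N ~> N)) : fm G :=
  All N (Ex (N ~> N) (leT v0 one1 &&& inT (bar v0 v1) (wk (wk T)))).

(* (forall m)(bar a m in T) *)
Definition path {G} (T a : tm G (N ~> N)) : fm G :=
  All N (inT (bar (wk a) v0) (wk T)).

Definition WKL : fm [] :=
  All (N ~> N) (binary_tree v0 ==>
    (infinite v0 ==> Ex (N ~> N) (leT v0 one1 &&& path v1 v0))).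

Definition UWKL : fm [] :=
  Ex ((N ~> N) ~> (N ~> N)) (All (N ~> N) (binary_tree v0 ==>
    (infinite v0 ==> path v0 (v1 @ v0)))).

(* Main.v *)
(** Idealization yields a number [n] that exceeds every standard number.  For a
    tree [T], let [depth T p c] be the length, cut off at [p], of the longest
    branch of [T] that starts at the node [c] (counting nodes), and let [greedy n T] be the 0-1-sequence
    that at step [k] moves to the child with the larger [depth T (n - (k + 1))].
    [greedy n] is strongly majorized by the constant functional 1, hence
    standard although [n] is not; this one functional witnesses UWKL^st, and its
    values witness WKL^st.  If [T] is infinite in the standard sense and [m] is
    standard, some standard 0-1-sequence [b] has its initial segments up to
    length [m] in [T]; descending from [m] by external induction, [bar b i] has depth
    greater than [m - i], in particular so has the root.  The greedy path keeps
    this invariant, so after [m] steps it is still in [T].  No choice principle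
    is needed. *)
From Stdlib Require Import List.
(* The signature notation of Morphisms clashes with the implication of Defs. *)
From Stdlib Require Import -(notations) Setoid Morphisms.
Require Import Defs.
Import ListNotations.
Set Implicit Arguments.
Unset Strict Implicit.
Unset Printing Implicit Defensive.
Local Open Scope ty_scope.
Local Open Scope tm_scope.
Local Open Scope fm_scope.

(** * Renaming and substitution *)

(** Plain induction on [var] forgets that the context is [r :: G]; the match keeps this shape by
    returning a trivial proposition at the empty context. *)
Lemma var_case (r : ty) (G : cx) (P : forall s, var (r :: G) s -> Prop) :
  P r VZ -> (forall s (w : var G s), P s (VS w)) -> forall s (v : var (r :: G) s), P s v.
Proof.
intros HZ HS s v.
exact (match v in var G' s' return
   match G' return var G' s' -> Prop with
   | [] => fun _ => True
   | q :: G0 => fun v => forall P : forall s, var (q :: G0) s -> Prop,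
        P q VZ -> (forall s w, P s (VS w)) -> P s' v
   end v
 with VZ => fun P HZ HS => HZ | VS w => fun P HZ HS => HS _ w end P HZ HS).
Qed.

Lemma sub_tm_ext G D (f g : sub G D) s (t : tm G s) :
  (forall r v, f r v = g r v) -> sub_tm f t = sub_tm g t.
Proof. intro E; induction t; simpl; congruence. Qed.

Lemma sub_ren_tm G D E (f : ren G D) (g : sub D E) s (t : tm G s) :
  sub_tm g (ren_tm f t) = sub_tm (fun r v => g r (f r v)) t.
Proof. induction t; simpl; congruence. Qed.

Lemma ren_sub_tm G D E (f : sub G D) (g : ren D E) s (t : tm G s) :
  ren_tm g (sub_tm f t) = sub_tm (fun r v => ren_tm g (f r v)) t.
Proof. induction t; simpl; congruence. Qed.

Lemma ren_ren_tm G D E (f : ren G D) (g : ren D E) s (t : tm G s) :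
  ren_tm g (ren_tm f t) = ren_tm (fun r v => g r (f r v)) t.
Proof. induction t; simpl; congruence. Qed.

Lemma sub_tm_id G s (t : tm G s) : sub_tm (fun r v => Var v) t = t.
Proof. induction t; simpl; congruence. Qed.

Lemma ren_as_sub G D (f : ren G D) s (t : tm G s) :
  ren_tm f t = sub_tm (fun r v => Var (f r v)) t.
Proof. induction t; simpl; congruence. Qed.

Lemma sub_scons_wk G D r (u : tm D r) (f : sub G D) s (t : tm G s) :
  sub_tm (scons u f) (wk t) = sub_tm f t.
Proof. apply sub_ren_tm. Qed.

Lemma sub_up_wk G D r (f : sub G D) s (t : tm G s) :
  sub_tm (up_sub (r := r) f) (wk t) = wk (sub_tm f t).
Proof. unfold wk. now rewrite sub_ren_tm, ren_sub_tm. Qed.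

Lemma ren_up_wk G D r (f : ren G D) s (t : tm G s) :
  ren_tm (up_ren (r := r) f) (wk t) = wk (ren_tm f t).
Proof. unfold wk. now rewrite !ren_ren_tm. Qed.

Lemma sub_closed G D (f : sub G D) s (t : tm [] s) :
  sub_tm f (closed_tm t) = closed_tm t.
Proof.
unfold closed_tm. rewrite sub_ren_tm, ren_as_sub. apply sub_tm_ext.
intros r v. inversion v.
Qed.

Lemma ren_closed G D (f : ren G D) s (t : tm [] s) :
  ren_tm f (closed_tm t) = closed_tm t.
Proof. rewrite ren_as_sub. apply sub_closed. Qed.

Lemma sub_fm_eqT s : forall G D (f : sub G D) (x y : tm G s),
  sub_fm (eqT x y) f = eqT (sub_tm f x) (sub_tm f y).
Proof.
induction s as [|r _ q IH]; intros G D f x y; [reflexivity|].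
cbn [eqT sub_fm]. rewrite IH. cbn [sub_tm]. now rewrite !sub_up_wk.
Qed.

Lemma ren_fm_eqT s : forall G D (f : ren G D) (x y : tm G s),
  ren_fm (eqT x y) f = eqT (ren_tm f x) (ren_tm f y).
Proof.
induction s as [|r _ q IH]; intros G D f x y; [reflexivity|].
cbn [eqT ren_fm]. rewrite IH. cbn [ren_tm]. now rewrite !ren_up_wk.
Qed.

Lemma wkf_eqT G r s (x y : tm G s) : wkf (r := r) (eqT x y) = eqT (wk x) (wk y).
Proof. apply ren_fm_eqT. Qed.

Lemma inst_eqT G r s (x y : tm (r :: G) s) t :
  inst (eqT x y) t = eqT (sub_tm (scons t (fun s v => Var v)) x) (sub_tm (scons t (fun s v => Var v)) y).
Proof. apply sub_fm_eqT. Qed.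

(** * Structural rules and equational reasoning under derivability *)

Lemma prf_weaken G (H : list (fm G)) A : prf H A -> forall H', incl H H' -> prf H' A.
Proof.
induction 1; intros H' I.
- apply prf_hyp; auto.
- now apply prf_ax.
- apply prf_botE; auto.
- apply prf_andI; auto.
- eapply prf_andE1; eauto.
- eapply prf_andE2; eauto.
- apply prf_orI1; auto.
- apply prf_orI2; auto.
- assert (forall A, incl (A :: H) (A :: H')) by
    (intros A0 B0 [->|K]; [left|right]; auto).
  eapply prf_orE; eauto.
- apply prf_impI, IHprf. intros B0 [->|K]; [left|right]; auto.
- eapply prf_impE; eauto.
- apply prf_allI, IHprf, incl_map, I.
- eapply prf_allE; auto.
- eapply prf_exI; auto.
- eapply prf_exE; [eauto|]. apply IHprf2.
  intros B0 [->|K]; [left|right]; auto. eapply incl_map; eauto.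
Qed.

Lemma prf_cons G (H : list (fm G)) A B : prf H A -> prf (B :: H) A.
Proof. intro P; apply (prf_weaken P), incl_tl, incl_refl. Qed.

Lemma prf_hyp0 G (H : list (fm G)) A : prf (A :: H) A.
Proof. apply prf_hyp; now left. Qed.

Lemma prf_cut G (H : list (fm G)) A B : prf H A -> prf (A :: H) B -> prf H B.
Proof. intros P Q. exact (prf_impE (prf_impI Q) P). Qed.

Lemma prf_mp_ax G (H : list (fm G)) A B : DGax (A ==> B) -> prf H A -> prf H B.
Proof. intros X. apply prf_impE, prf_ax, X. Qed.

Lemma prf_eha G (H : list (fm G)) A : EHA A -> prf H A.
Proof. intro E. apply prf_ax, DG_EHA, E. Qed.

(** For a fixed hypothesis list this is an equivalence relation at the meta level, so that setoid
    rewriting can carry out the equational reasoning of the object system. *)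
Definition eqv G (H : list (fm G)) s (x y : tm G s) : Prop := prf H (eqT x y).
Arguments eqv {G} H {s} x y.

Lemma eqT_refl s : forall G (H : list (fm G)) (x : tm G s), eqv H x x.
Proof.
unfold eqv. induction s as [|r _ q IH]; intros G H x.
- apply prf_eha, EHA_refl.
- cbn [eqT]. apply prf_allI, IH.
Qed.

Lemma eqT_app1 G (H : list (fm G)) r s (f g : tm G (r ~> s)) x :
  eqv H f g -> eqv H (f @ x) (g @ x).
Proof.
unfold eqv. intro E. cbn [eqT] in E. apply prf_allE with (t := x) in E.
rewrite inst_eqT in E. cbn [sub_tm] in E.
now rewrite !sub_scons_wk, !sub_tm_id in E.
Qed.

Lemma eqT_sym s : forall G (H : list (fm G)) (x y : tm G s), eqv H x y -> eqv H y x.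
Proof.
induction s as [|r _ q IH]; intros G H x y E.
- exact (prf_mp_ax (DG_EHA (EHA_sym _ _)) E).
(* The quantifier rule carries hypotheses, not derivations, into the larger context; hence the
   equation is first cut into the hypotheses. The same device recurs below. *)
- apply (prf_cut E). unfold eqv; cbn [eqT].
  apply prf_allI, IH, eqT_app1. unfold eqv. rewrite <- wkf_eqT. apply prf_hyp0.
Qed.

Lemma eqT_trans s : forall G (H : list (fm G)) (x y z : tm G s),
  eqv H x y -> eqv H y z -> eqv H x z.
Proof.
induction s as [|r _ q IH]; intros G H x y z E F.
- exact (prf_impE (prf_mp_ax (DG_EHA (EHA_trans _ _ _)) E) F).
- apply (prf_cut E), (prf_cut (prf_cons _ F)). unfold eqv; cbn [eqT].
  apply prf_allI. apply IH with (y := wk y @ v0); apply eqT_app1; unfold eqv;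
    rewrite <- wkf_eqT; [apply prf_cons|]; apply prf_hyp0.
Qed.

#[export] Instance eqv_equiv G (H : list (fm G)) s : Equivalence (@eqv G H s).
Proof.
split; red; intros; [apply eqT_refl|apply eqT_sym; auto|eapply eqT_trans; eauto].
Qed.

#[export] Instance app_proper G (H : list (fm G)) r s :
  Proper (respectful (eqv H) (respectful (eqv H) (eqv H))) (@App G r s).
Proof.
intros f g E x y F. transitivity (f @ y).
- exact (prf_mp_ax (DG_EHA (EHA_ext _ _ _)) F).
- now apply eqT_app1.
Qed.

(** Equiderivability from [H] is weaker than a derivable biimplication, yet enough to rewrite in an
    atomic goal. *)
Definition feqv G (H : list (fm G)) (A B : fm G) : Prop := prf H A <-> prf H B.
Arguments feqv {G} H A B.

#[export] Instance feqv_equiv G (H : list (fm G)) : Equivalence (@feqv G H).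
Proof. unfold feqv; split; red; intros; tauto. Qed.

#[export] Instance prf_proper G (H : list (fm G)) : Proper (respectful (feqv H) iff) (@prf G H).
Proof. intros A B E; exact E. Qed.

#[export] Instance Eq0_proper G (H : list (fm G)) :
  Proper (respectful (eqv H) (respectful (eqv H) (feqv H))) (@Eq0 G).
Proof.
intros x y E x' y' E'. change (eqv H x x' <-> eqv H y y'). now rewrite E, E'.
Qed.

#[export] Instance St_proper G (H : list (fm G)) s : Proper (respectful (eqv H) (feqv H)) (@St G s).
Proof.
intros x y E; split; intro P;
  refine (prf_impE (prf_mp_ax (DG_st_eq _ _) _) P); [|apply eqT_sym]; exact E.
Qed.

(* Substituting a compound term does not commute with [lam], hence not with
   [bar], up to syntactic equality; replacing the term by a variable first
   avoids this.  For the same reason trees and sequences are variables below. *)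
Lemma prf_name G (H : list (fm G)) s (t : tm G s) B :
  prf (eqT v0 (wk t) :: map wkf H) (wkf B) -> prf H B.
Proof.
apply prf_exE. apply prf_exI with (t := t). rewrite inst_eqT.
rewrite sub_scons_wk, sub_tm_id. apply eqT_refl.
Qed.

(** * Combinators *)

Lemma Pi_eq G (H : list (fm G)) r s (x : tm G r) (y : tm G s) :
  eqv H (Cst (cPi r s) @ x @ y) x.
Proof. apply prf_eha, EHA_Pi. Qed.

Lemma Sig_eq G (H : list (fm G)) d r s (x : tm G (d ~> r ~> s)) y z :
  eqv H (Cst (cSig d r s) @ x @ y @ z) (x @ z @ (y @ z)).
Proof. apply prf_eha, EHA_Sig. Qed.

(** The substitution [f] is built in because [sub_tm f (lam t)] is in general not of the form [lam];
    this version can be iterated through nested abstractions. *)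
Lemma beta_sub G D (H : list (fm D)) r s (f : sub G D) (t : tm (r :: G) s) u :
  eqv H (sub_tm f (lam t) @ u) (sub_tm (scons u f) t).
Proof.
induction t as [s v|s c|p q t IHt t' IHt'].
- revert s v. apply var_case; intros; cbn [lam sub_tm scons].
  + rewrite Sig_eq. apply Pi_eq.
  + apply Pi_eq.
- apply Pi_eq.
- cbn [lam sub_tm]. now rewrite Sig_eq, IHt, IHt'.
Qed.

Lemma beta G (H : list (fm G)) r s (t : tm (r :: G) s) u :
  eqv H (lam t @ u) (sub_tm (scons u (fun s v => Var v)) t).
Proof. rewrite <- beta_sub. now rewrite sub_tm_id. Qed.

Lemma Rec0 G (H : list (fm G)) r (y : tm G r) z : eqv H (rec_ Z y z) y.
Proof. apply prf_eha, EHA_Rec0. Qed.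

Lemma RecS G (H : list (fm G)) r x (y : tm G r) z :
  eqv H (rec_ (Sc x) y z) (z @ rec_ x y z @ x).
Proof. apply prf_eha, EHA_RecS. Qed.

#[export] Instance Sc_proper G (H : list (fm G)) : Proper (respectful (eqv H) (eqv H)) (@Sc G).
Proof. intros x y E; unfold Sc; now rewrite E. Qed.

#[export] Instance rec_proper G (H : list (fm G)) r :
  Proper (respectful (eqv H) (respectful (eqv H) (respectful (eqv H) (eqv H)))) (@rec_ G r).
Proof. intros x y E x' y' E' x'' y'' E''; unfold rec_; now rewrite E, E', E''. Qed.

#[export] Instance pred_proper G (H : list (fm G)) : Proper (respectful (eqv H) (eqv H)) (@pred_ G).
Proof. intros x y E; unfold pred_; now rewrite E. Qed.

#[export] Instance monus_proper G (H : list (fm G)) :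
  Proper (respectful (eqv H) (respectful (eqv H) (eqv H))) (@monus G).
Proof. intros x y E x' y' E'; unfold monus; now rewrite E, E'. Qed.

#[export] Instance add_proper G (H : list (fm G)) :
  Proper (respectful (eqv H) (respectful (eqv H) (eqv H))) (@add_ G).
Proof. intros x y E x' y' E'; unfold add_; now rewrite E, E'. Qed.

#[export] Instance snoc_proper G (H : list (fm G)) :
  Proper (respectful (eqv H) (respectful (eqv H) (eqv H))) (@snoc G).
Proof. intros x y E x' y' E'; unfold snoc, pair_, tri; now rewrite E, E'. Qed.

#[export] Instance le0_proper G (H : list (fm G)) :
  Proper (respectful (eqv H) (respectful (eqv H) (feqv H))) (@le0 G).
Proof. intros x y E x' y' E'; unfold le0; now rewrite E, E'. Qed.

Lemma pred_0 G (H : list (fm G)) : eqv H (pred_ Z) Z.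
Proof. apply Rec0. Qed.

Lemma beta2 G (H : list (fm G)) r q s (t : tm (q :: r :: G) s) u w :
  eqv H (lam (lam t) @ u @ w) (sub_tm (scons w (scons u (fun s v => Var v))) t).
Proof. now rewrite beta, beta_sub. Qed.

Lemma pred_S G (H : list (fm G)) x : eqv H (pred_ (Sc x)) x.
Proof. unfold pred_. now rewrite RecS, beta2. Qed.

Lemma monus_0 G (H : list (fm G)) x : eqv H (monus x Z) x.
Proof. apply Rec0. Qed.

Lemma monus_S G (H : list (fm G)) x y : eqv H (monus x (Sc y)) (pred_ (monus x y)).
Proof. unfold monus at 1. now rewrite RecS, beta2. Qed.

Lemma add_0 G (H : list (fm G)) x : eqv H (add_ x Z) x.
Proof. apply Rec0. Qed.

Lemma add_S G (H : list (fm G)) x y : eqv H (add_ x (Sc y)) (Sc (add_ x y)).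
Proof. unfold add_ at 1. now rewrite RecS, beta2. Qed.

Lemma bar_0 G (H : list (fm G)) a : eqv H (bar a Z) Z.
Proof. apply Rec0. Qed.

Lemma bar_S G (H : list (fm G)) a x : eqv H (bar a (Sc x)) (snoc (bar a x) (a @ x)).
Proof.
unfold bar at 1. rewrite RecS, beta2.
change (eqv H (snoc (bar a x) (sub_tm (scons x (scons (bar a x) (fun s v => Var v))) (wk (wk a)) @ x)) (snoc (bar a x) (a @ x))).
now rewrite !sub_scons_wk, sub_tm_id.
Qed.

(** For the arithmetic functions these laws hold by computation, since the step functions of their
    recursions are closed. The step function of [bar] contains the sequence, so [bar] is treated
    separately. *)
Lemma sub_Sc G D (f : sub G D) x : sub_tm f (Sc x) = Sc (sub_tm f x).
Proof. reflexivity. Qed.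
Lemma sub_pred G D (f : sub G D) x : sub_tm f (pred_ x) = pred_ (sub_tm f x).
Proof. reflexivity. Qed.
Lemma sub_add G D (f : sub G D) x y : sub_tm f (add_ x y) = add_ (sub_tm f x) (sub_tm f y).
Proof. reflexivity. Qed.
Lemma sub_monus G D (f : sub G D) x y : sub_tm f (monus x y) = monus (sub_tm f x) (sub_tm f y).
Proof. reflexivity. Qed.
Lemma sub_snoc G D (f : sub G D) x y : sub_tm f (snoc x y) = snoc (sub_tm f x) (sub_tm f y).
Proof. reflexivity. Qed.
Lemma sub_rec G D (f : sub G D) r n (x : tm G r) y :
  sub_tm f (rec_ n x y) = rec_ (sub_tm f n) (sub_tm f x) (sub_tm f y).
Proof. reflexivity. Qed.
Lemma sub_le0 G D (f : sub G D) x y :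
  sub_fm (le0 x y) f = le0 (sub_tm f x) (sub_tm f y).
Proof. reflexivity. Qed.

Ltac syn := unfold inst, eqv; cbn [eqT]; repeat progress
  (rewrite ?sub_le0, ?sub_Sc, ?sub_pred, ?sub_monus,
     ?sub_scons_wk, ?sub_up_wk, ?sub_tm_id;
   cbn [sub_fm sub_tm scons up_sub v0 v1 v2 Z]).

(** * Arithmetic *)

Lemma ind_rule G (H : list (fm G)) (A : fm (N :: G)) : internal A ->
  prf H (inst A Z) ->
  prf (A :: map wkf H) (sub_fm A (scons (Sc v0) (fun s v => Var (VS v)))) ->
  forall t, prf H (inst A t).
Proof.
intros I P Q t. apply prf_allE. eapply prf_impE; [apply prf_eha, EHA_induction, I|].
apply prf_andI; [exact P|]. now apply prf_allI, prf_impI.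
Qed.

(** The step is stated for every [H'] above the weakened hypotheses, so that the induction
    hypothesis arrives as an [eqv] ready for rewriting. *)
Lemma eq_ind_rule G (H : list (fm G)) (a b : tm (N :: G) N) t :
  let sb := fun u => sub_tm (scons u (fun s v => Var v)) in
  let sb' := sub_tm (scons (Sc v0) (fun s v => Var (VS v))) in
  eqv H (sb Z a) (sb Z b) ->
  (forall H' : list (fm (N :: G)), incl (map wkf H) H' -> eqv H' a b -> eqv H' (sb' a) (sb' b)) ->
  eqv H (sb t a) (sb t b).
Proof.
intros sb sb' P Q. apply (@ind_rule _ _ (a =0 b)); [exact I|exact P|apply Q; [apply incl_tl, incl_refl|apply prf_hyp0]].
Qed.

Lemma sub_VS_wk G s r (u : tm G s) :
  sub_tm (fun s v => Var (VS (r := r) v)) u = wk u.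
Proof. symmetry; apply ren_as_sub. Qed.

(** The logic being intuitionistic, this case distinction is itself proved by induction. Writing the
    predecessor as [pred_ x] avoids an existential quantifier and hence a change of context. *)
Lemma num_case G (H : list (fm G)) (x : tm G N) C :
  (forall H', incl H H' -> eqv H' x Z -> prf H' C) ->
  (forall H', incl H H' -> eqv H' x (Sc (pred_ x)) -> prf H' C) -> prf H C.
Proof.
intros P Q. apply prf_orE with (A := x =0 Z) (B := x =0 Sc (pred_ x)).
- apply (ind_rule (A := v0 =0 Z ||| v0 =0 Sc (pred_ v0))); [cbn; auto|..].
  + apply prf_orI1. exact (eqT_refl H (Z : tm G N)).
  + apply prf_orI2. syn.
    match goal with |- prf ?K (?x =0 ?y) => change (eqv K x y) end.
    now rewrite pred_S.
- apply P; [apply incl_tl, incl_refl|apply prf_hyp0].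
- apply Q; [apply incl_tl, incl_refl|apply prf_hyp0].
Qed.

Lemma S_nz G (H : list (fm G)) (x : tm G N) C : eqv H (Sc x) Z -> prf H C.
Proof. intro E. apply prf_botE. exact (prf_mp_ax (DG_EHA (EHA_S_nz _)) E). Qed.

Lemma add_0l G (H : list (fm G)) x : eqv H (add_ Z x) x.
Proof.
apply (eq_ind_rule (a := add_ Z v0) (b := v0)); [apply add_0|].
intros H' _ E. change (eqv H' (add_ Z (Sc v0)) (Sc v0)). now rewrite add_S, E.
Qed.

Lemma add_Sl G (H : list (fm G)) x y : eqv H (add_ (Sc x) y) (Sc (add_ x y)).
Proof.
pose proof (eq_ind_rule (H := H) (a := add_ (Sc (wk x)) v0) (b := Sc (add_ (wk x) v0)) y) as K.
revert K. cbv zeta. rewrite !sub_Sc, !sub_add, !sub_Sc, !sub_scons_wk, !sub_tm_id, sub_VS_wk.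
cbn [sub_tm scons v0 Z]. intro K; apply K.
- now rewrite !add_0.
- intros H' _ E. now rewrite !add_S, E.
Qed.

Lemma monus_SS G (H : list (fm G)) x y : eqv H (monus (Sc x) (Sc y)) (monus x y).
Proof.
pose proof (eq_ind_rule (H := H) (a := monus (Sc (wk x)) (Sc v0)) (b := monus (wk x) v0) y) as K.
revert K. cbv zeta. rewrite !sub_monus, !sub_Sc, !sub_scons_wk, !sub_tm_id, sub_VS_wk.
cbn [sub_tm scons v0 Z]. intro K; apply K.
- now rewrite monus_S, !monus_0, pred_S.
- intros H' _ E. now rewrite monus_S, E, monus_S.
Qed.

Lemma le_S G (H : list (fm G)) x y : prf H (le0 (Sc x) (Sc y)) <-> prf H (le0 x y).
Proof. unfold le0. now rewrite monus_SS. Qed.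

Lemma le_refl G (H : list (fm G)) x : prf H (le0 x x).
Proof.
apply (eq_ind_rule (H := H) (a := monus v0 v0) (b := Z) x); [apply monus_0|].
intros H' _ E. change (eqv H' (monus (Sc v0) (Sc v0)) Z). now rewrite monus_SS.
Qed.

Lemma le_0 G (H : list (fm G)) x : prf H (le0 Z x).
Proof.
apply (eq_ind_rule (H := H) (a := monus Z v0) (b := Z) x); [apply monus_0|].
intros H' _ E. change (eqv H' (monus Z (Sc v0)) Z). now rewrite monus_S, E, pred_0.
Qed.

Lemma le_eq G (H : list (fm G)) x x' y y' :
  eqv H x x' -> eqv H y y' -> prf H (le0 x' y') -> prf H (le0 x y).
Proof. intros E E'. now rewrite E, E'. Qed.

Lemma not_le_S_0 G (H : list (fm G)) x C : prf H (le0 (Sc x) Z) -> prf H C.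
Proof. unfold le0. rewrite monus_0. apply S_nz. Qed.

Lemma le_S_n_n G (H : list (fm G)) x C : prf H (le0 (Sc x) x) -> prf H C.
Proof.
assert (E : eqv H (monus (Sc x) x) (Sc Z)).
{ apply (eq_ind_rule (H := H) (a := monus (Sc v0) v0) (b := Sc Z) x); [apply monus_0|].
  intros H' _ E. change (eqv H' (monus (Sc (Sc v0)) (Sc v0)) (Sc Z)). now rewrite monus_SS. }
unfold le0. rewrite E. apply S_nz.
Qed.

Lemma eqv_weaken G (H H' : list (fm G)) s (x y : tm G s) :
  eqv H x y -> incl H H' -> eqv H' x y.
Proof. intros E S. exact (prf_weaken E S). Qed.

Lemma le_1 G (H : list (fm G)) x C : prf H (le0 x (Sc Z)) ->
  (forall H', incl H H' -> eqv H' x Z -> prf H' C) ->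
  (forall H', incl H H' -> eqv H' x (Sc Z) -> prf H' C) -> prf H C.
Proof.
intros L P Q. apply (num_case (x := x)); [exact P|].
intros H' S E. apply Q; [exact S|]. apply prf_weaken with (H' := H') in L; [|exact S].
rewrite E in L. rewrite le_S in L. unfold le0 in L. rewrite monus_0 in L.
change (eqv H' (pred_ x) Z) in L. now rewrite L in E.
Qed.

Lemma sub_allE G D (H : list (fm D)) s (B : fm (s :: G)) (f : sub G D) t :
  prf H (sub_fm (All s B) f) -> prf H (sub_fm (sub_fm B (up_sub f)) (scons t (fun s v => Var v))).
Proof. apply prf_allE. Qed.

Definition v3 {G s r q p} : tm (p :: q :: r :: s :: G) s := Var (VS (VS (VS VZ))).
Definition v4 {G s r q p o} : tm (o :: p :: q :: r :: s :: G) s := Var (VS (VS (VS (VS VZ)))).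

(** Induction on [x] with the other number universally quantified, followed by cases on that number;
    two successors reduce to the induction hypothesis at the predecessor. *)
Lemma le_total G (H : list (fm G)) x y C :
  (prf (le0 x y :: H) C) -> (prf (le0 y x :: H) C) -> prf H C.
Proof.
apply prf_orE.
pose proof (@ind_rule G H (All N (le0 v1 v0 ||| le0 v0 v1))) as K.
assert (P : prf H (inst (All N (le0 v1 v0 ||| le0 v0 v1)) x)).
{ apply K; clear K.
  - cbn; auto.
  - apply prf_allI, prf_orI1. apply le_0.
  - apply prf_allI. syn. apply (num_case (x := v0)); intros H' S E.
    + apply prf_orI2. rewrite E. apply le_0.
    + change (prf H' (le0 (Sc v1) v0 ||| le0 v0 (Sc v1))).
      apply prf_orE with (A := le0 v1 (pred_ v0)) (B := le0 (pred_ v0) v1).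
      * refine (prf_allE (A := le0 v2 v0 ||| le0 v0 v2) (pred_ v0) _).
        apply prf_hyp, S. now left.
      * apply prf_orI1. apply (le_eq (reflexivity _) (prf_cons _ E)).
        apply le_S, prf_hyp0.
      * apply prf_orI2. apply (le_eq (prf_cons _ E) (reflexivity _)).
        apply le_S, prf_hyp0. }
apply sub_allE with (t := y) in P. revert P. syn. auto.
Qed.

Lemma le_trans G (H : list (fm G)) x y z :
  prf H (le0 x y) -> prf H (le0 y z) -> prf H (le0 x z).
Proof.
intros L M. refine (prf_impE (prf_impE _ L) M); clear.
(* Both other numbers are quantified inside the induction formula, because the hypothesis is applied
   to their predecessors. *)
set (A := All N (All N (le0 v2 v1 ==> le0 v1 v0 ==> le0 v2 v0)) : fm (N :: G)).
assert (P : prf H (inst A x)).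
{ apply (@ind_rule G H A).
  - cbn; auto.
  - apply prf_allI, prf_allI, prf_impI, prf_impI. apply le_0.
  - apply prf_allI, prf_allI. syn.
    change (prf (wkf (r:=N) (wkf (r:=N) A) :: map wkf (map wkf (map wkf H))) (le0 (Sc v2) v1 ==> le0 v1 v0 ==> le0 (Sc v2) v0)).
    apply prf_impI, prf_impI.
    apply (num_case (x := v1)); intros H' S E.
    { apply (@not_le_S_0 _ _ v2), (le_eq (reflexivity _) (symmetry E)).
      apply prf_hyp, S. right; now left. }
    apply (num_case (x := v0)); intros H'' S' E'.
    { apply eqv_weaken with (H' := H'') in E; [|exact S'].
      apply (@not_le_S_0 _ _ (pred_ v1)), (le_eq (symmetry E) (symmetry E')).
      apply prf_hyp, S', S. now left. }
    apply eqv_weaken with (H' := H'') in E; [|exact S'].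
    apply (le_eq (reflexivity _) E'), le_S.
    refine (prf_impE (prf_impE (A := le0 v2 (pred_ v1)) _ _) _ (A := le0 (pred_ v1) (pred_ v0))).
    + refine (prf_allE (A := le0 v3 (wk (pred_ v1)) ==> le0 (wk (pred_ v1)) v0 ==> le0 v3 v0) (pred_ v0) _).
      refine (prf_allE (A := All N (le0 v4 v1 ==> le0 v1 v0 ==> le0 v4 v0)) (pred_ v1) _).
      apply prf_hyp, S', S. now right; right; left.
    + apply le_S, (le_eq (reflexivity _) (symmetry E)). apply prf_hyp, S', S. right; now left.
    + apply le_S, (le_eq (symmetry E) (symmetry E')). apply prf_hyp, S', S. now left. }
apply sub_allE with (t := y) in P. cbn [sub_fm] in P.
apply prf_allE with (t := z) in P. revert P. syn. auto.
Qed.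

(** * Depth of a tree above a node *)

Definition sel {G r} (t : tm G N) (a b : tm G r) : tm G r :=
  rec_ t a (Cst (cPi _ _) @ (Cst (cPi _ _) @ b)).

Definition mx {G} (x y : tm G N) : tm G N := sel (monus y x) x y.

(** From [v3] to [v0]: the tree, the depth function with cut-off one smaller, the recursion counter,
    the node. The two nested [sel] test whether the tree takes the value 1 at the node. *)
Definition depth_step : tm [] ((N ~> N) ~> (N ~> N) ~> N ~> N ~> N) :=
  lam (lam (lam (lam
    (sel (v3 @ v0) Z
      (sel (pred_ (v3 @ v0))
        (Sc (mx (v2 @ snoc v0 Z) (v2 @ snoc v0 (Sc Z)))) Z))))).

Definition depth {G} (T : tm G (N ~> N)) (n c : tm G N) : tm G N :=
  rec_ n (Cst (cPi _ _) @ Z) (closed_tm depth_step @ T) @ c.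

(** Ties go to the child 0. The test is the same term as in [mx] applied to the two depths, which is
    why [mx_bit] holds. *)
Definition bit {G} (T : tm G (N ~> N)) (p c : tm G N) : tm G N :=
  sel (monus (depth T p (snoc c (Sc Z))) (depth T p (snoc c Z))) Z (Sc Z).

Definition code_step : tm [] (N ~> (N ~> N) ~> N ~> N ~> N) :=
  lam (lam (lam (lam (snoc v1 (bit v2 (monus v3 (Sc v0)) v1))))).

(** The node reached after [k] greedy steps. It comes before [greedy] since each bit depends on the
    node reached so far; [bar_greedy] identifies it with an initial segment of the greedy
    sequence. *)
Definition code {G} (n : tm G N) (T : tm G (N ~> N)) (k : tm G N) : tm G N :=
  rec_ k Z (closed_tm code_step @ n @ T).

Definition greedy0 : tm [] (N ~> (N ~> N) ~> N ~> N) :=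
  lam (lam (lam (bit v1 (monus v2 (Sc v0)) (code v2 v1 v0)))).

Definition greedy {G} (n : tm G N) : tm G ((N ~> N) ~> N ~> N) :=
  closed_tm greedy0 @ n.

Lemma sel_0 G (H : list (fm G)) r t (a b : tm G r) : eqv H t Z -> eqv H (sel t a b) a.
Proof. intro E. unfold sel. rewrite E. apply Rec0. Qed.

Lemma sel_S G (H : list (fm G)) r t p (a b : tm G r) : eqv H t (Sc p) -> eqv H (sel t a b) b.
Proof. intro E. unfold sel. now rewrite E, RecS, Pi_eq, Pi_eq. Qed.

#[export] Instance sel_proper G (H : list (fm G)) r :
  Proper (respectful (eqv H) (respectful (eqv H) (respectful (eqv H) (eqv H)))) (@sel G r).
Proof. intros x y E x' y' E' x'' y'' E''; unfold sel; now rewrite E, E', E''. Qed.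

#[export] Instance depth_proper G (H : list (fm G)) :
  Proper (respectful (eqv H) (respectful (eqv H) (respectful (eqv H) (eqv H)))) (@depth G).
Proof. intros x y E x' y' E' x'' y'' E''; unfold depth; now rewrite E, E', E''. Qed.

#[export] Instance bit_proper G (H : list (fm G)) :
  Proper (respectful (eqv H) (respectful (eqv H) (respectful (eqv H) (eqv H)))) (@bit G).
Proof. intros x y E x' y' E' x'' y'' E''; unfold bit; now rewrite E, E', E''. Qed.

Lemma sub_depth G D (f : sub G D) T n c :
  sub_tm f (depth T n c) = depth (sub_tm f T) (sub_tm f n) (sub_tm f c).
Proof. unfold depth. cbn [sub_tm]. rewrite sub_rec. cbn [sub_tm]. now rewrite sub_closed. Qed.

Lemma sub_sel G D (f : sub G D) r t (a b : tm G r) :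
  sub_tm f (sel t a b) = sel (sub_tm f t) (sub_tm f a) (sub_tm f b).
Proof. reflexivity. Qed.

Lemma sub_bit G D (f : sub G D) T n c :
  sub_tm f (bit T n c) = bit (sub_tm f T) (sub_tm f n) (sub_tm f c).
Proof. unfold bit. now rewrite sub_sel, sub_monus, !sub_depth, !sub_snoc. Qed.

Lemma sub_code G D (f : sub G D) T n c :
  sub_tm f (code T n c) = code (sub_tm f T) (sub_tm f n) (sub_tm f c).
Proof. unfold code. rewrite sub_rec. cbn [sub_tm]. now rewrite sub_closed. Qed.

Lemma ren_depth G D (f : ren G D) T n c :
  ren_tm f (depth T n c) = depth (ren_tm f T) (ren_tm f n) (ren_tm f c).
Proof. now rewrite !ren_as_sub, sub_depth. Qed.

Lemma ren_code G D (f : ren G D) n T k :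
  ren_tm f (code n T k) = code (ren_tm f n) (ren_tm f T) (ren_tm f k).
Proof. now rewrite !ren_as_sub, sub_code. Qed.

Lemma wk_greedy G r (n : tm G N) : wk (r := r) (greedy n) = greedy (wk n).
Proof. unfold greedy, wk. cbn [ren_tm]. now rewrite ren_closed. Qed.

Lemma depth_0 G (H : list (fm G)) T c : eqv H (depth T Z c) Z.
Proof. unfold depth. now rewrite Rec0, Pi_eq. Qed.

Lemma depth_S G (H : list (fm G)) T n c : eqv H (depth T (Sc n) c)
  (sel (T @ c) Z (sel (pred_ (T @ c))
    (Sc (mx (depth T n (snoc c Z)) (depth T n (snoc c (Sc Z))))) Z)).
Proof.
unfold depth at 1. rewrite RecS. unfold depth_step at 1, closed_tm at 1.
rewrite ren_as_sub, !beta_sub. reflexivity.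
Qed.

Lemma code_0 G (H : list (fm G)) n T : eqv H (code n T Z) Z.
Proof. apply Rec0. Qed.

Lemma code_S G (H : list (fm G)) n T k : eqv H (code n T (Sc k))
  (snoc (code n T k) (bit T (monus n (Sc k)) (code n T k))).
Proof.
unfold code at 1. rewrite RecS. unfold code_step at 1, closed_tm at 1.
rewrite ren_as_sub, !beta_sub, sub_snoc, sub_bit, sub_monus, sub_Sc. reflexivity.
Qed.

Lemma greedy_eq G (H : list (fm G)) n T k :
  eqv H (greedy n @ T @ k) (bit T (monus n (Sc k)) (code n T k)).
Proof.
unfold greedy. unfold greedy0, closed_tm at 1.
rewrite ren_as_sub, !beta_sub, sub_bit, sub_monus, sub_code, sub_Sc. reflexivity.
Qed.

(* The normal forms of these terms are huge: a conversion problem that looks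
   inside them does not terminate in practice. *)
#[global] Opaque depth depth_step code code_step greedy greedy0.

Lemma le_bit G (H : list (fm G)) T p c : prf H (le0 (bit T p c) (Sc Z)).
Proof.
unfold bit. apply (num_case (x := monus (depth T p (snoc c (Sc Z))) (depth T p (snoc c Z)))).
- intros H' _ E. apply (le_eq (sel_0 _ _ E) (reflexivity _)), le_0.
- intros H' _ E. apply (le_eq (sel_S _ _ E) (reflexivity _)), le_refl.
Qed.

Lemma le_mx G (H : list (fm G)) x y : prf H (le0 x (mx x y)) /\ prf H (le0 y (mx x y)).
Proof.
assert (K : prf H (le0 x (mx x y) &&& le0 y (mx x y))).
{ apply (num_case (x := monus y x)); intros H' _ F.
  - assert (M : eqv H' (mx x y) x) by apply sel_0, F.
    apply prf_andI; [apply (le_eq (reflexivity _) M), le_refl|].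
    exact (le_eq (reflexivity _) M F).
  - assert (M : eqv H' (mx x y) y) by exact (sel_S _ _ F).
    apply prf_andI; apply (le_eq (reflexivity _) M); [|apply le_refl].
    apply (le_total (x := x) (y := y)); [apply prf_hyp0|].
    apply S_nz with (x := pred_ (monus y x)).
    transitivity (monus y x); [symmetry; apply prf_cons, F|apply prf_hyp0]. }
split; [eapply prf_andE1|eapply prf_andE2]; eassumption.
Qed.

Lemma mx_bit G (H : list (fm G)) T p c :
  eqv H (mx (depth T p (snoc c Z)) (depth T p (snoc c (Sc Z)))) (depth T p (snoc c (bit T p c))).
Proof.
unfold eqv. cbn [eqT].
apply (num_case (x := monus (depth T p (snoc c (Sc Z))) (depth T p (snoc c Z)))); intros H' _ E.
- assert (M : eqv H' (bit T p c) Z) by exact (sel_0 _ _ E).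
  change (eqv H' (mx (depth T p (snoc c Z)) (depth T p (snoc c (Sc Z)))) (depth T p (snoc c (bit T p c)))).
  rewrite M. apply sel_0, E.
- assert (M : eqv H' (bit T p c) (Sc Z)) by exact (sel_S _ _ E).
  change (eqv H' (mx (depth T p (snoc c Z)) (depth T p (snoc c (Sc Z)))) (depth T p (snoc c (bit T p c)))).
  rewrite M. exact (sel_S _ _ E).
Qed.

(** One step of the greedy walk. The depth vanishes at cut-off 0 and off the tree; otherwise it is
    one more than the larger depth of the two children, which [mx_bit] locates at the greedy
    child. *)
Lemma depth_pos G (H : list (fm G)) T n k c : prf H (le0 (Sc k) (depth T n c)) ->
  eqv H (T @ c) (Sc Z) /\ prf H (le0 k (depth T (pred_ n) (snoc c (bit T (pred_ n) c)))).
Proof.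
intro L.
assert (K : prf H (T @ c =0 Sc Z &&& le0 k (depth T (pred_ n) (snoc c (bit T (pred_ n) c))))).
{ apply (num_case (x := n)); intros H1 S1 E1; apply (prf_weaken L) in S1; clear L.
  { apply (@not_le_S_0 _ _ k). refine (le_eq (reflexivity _) _ S1).
    now rewrite E1, depth_0. }
  assert (E : eqv H1 (depth T n c) (depth T (Sc (pred_ n)) c)) by now rewrite <- E1.
  rewrite depth_S in E. revert S1 E. generalize (pred_ n) as p. intros p L E. clear E1.
  (* The value at [c] is 0, 1 or at least 2, and the depth is positive only for the value 1. *)
  apply (num_case (x := T @ c)); intros H2 S2 E2; apply (prf_weaken L) in S2 as L2;
    apply eqv_weaken with (H' := H2) in E; try exact S2.
  { apply (@not_le_S_0 _ _ k). refine (le_eq (reflexivity _) _ L2).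
    rewrite E. symmetry. now apply sel_0. }
  assert (E' := sel_S Z (sel (pred_ (T @ c))
         (Sc (mx (depth T p (snoc c Z)) (depth T p (snoc c (Sc Z))))) Z) E2).
  rewrite E' in E. clear L E' S2.
  apply (num_case (x := pred_ (T @ c))); intros H3 S3 E3; apply (prf_weaken L2) in S3 as L3;
    apply eqv_weaken with (H' := H3) in E; try exact S3.
  2:{ apply (@not_le_S_0 _ _ k). refine (le_eq (reflexivity _) _ L3).
    rewrite E. symmetry. exact (sel_S _ _ E3). }
  apply eqv_weaken with (H' := H3) in E2; try exact S3.
  apply prf_andI.
  { change (eqv H3 (T @ c) (Sc Z)). now rewrite E2, E3. }
  apply le_S. refine (le_eq (reflexivity _) _ L3).
  rewrite E, <- mx_bit. symmetry. now apply sel_0. }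
split; [eapply prf_andE1|eapply prf_andE2]; eassumption.
Qed.

Lemma depth_node G (H : list (fm G)) T p c : eqv H (T @ c) (Sc Z) ->
  eqv H (depth T (Sc p) c)
    (Sc (mx (depth T p (snoc c Z)) (depth T p (snoc c (Sc Z))))).
Proof.
intro E. rewrite depth_S. rewrite (sel_S _ _ E). apply sel_0. now rewrite E, pred_S.
Qed.

(** Conversely, any child, not only the greedy one, bounds the depth of its parent from below, as
    the maximum dominates both. *)
Lemma depth_child G (H : list (fm G)) T p c b k : eqv H (T @ c) (Sc Z) ->
  prf H (le0 b (Sc Z)) -> prf H (le0 k (depth T p (snoc c b))) ->
  prf H (le0 (Sc k) (depth T (Sc p) c)).
Proof.
intros E B L. apply (le_eq (reflexivity _) (depth_node p E)), le_S.
apply (le_1 B); intros H' S M; apply (prf_weaken L) in S;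
  rewrite M in S; apply (le_trans S), le_mx.
Qed.

Lemma ren_lam G D r s (t : tm (r :: G) s) : forall (f : ren G D),
  ren_tm f (lam t) = lam (ren_tm (up_ren f) t).
Proof.
intro f. induction t as [s v|s c|p q t IHt t' IHt'].
- revert s v. apply var_case; reflexivity.
- reflexivity.
- cbn [lam ren_tm]. now rewrite IHt, IHt'.
Qed.

(** Renaming, unlike substitution, commutes with [lam]. With the step function exhibited as a
    weakening, instantiating the new variable simply cancels it. *)
Lemma bar_wk G r (a : tm G (N ~> N)) (n : tm (r :: G) N) :
  bar (wk a) n = rec_ n Z (wk (lam (lam (snoc v1 (wk (wk a) @ v0))))).
Proof.
unfold bar, wk at 4. rewrite !ren_lam.
change (rec_ n Z (lam (lam (snoc v1 (wk (wk (wk a)) @ v0)))) =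
  rec_ n Z (lam (lam (snoc v1 (ren_tm (up_ren (up_ren shift)) (wk (wk a)) @ v0))))).
now rewrite !ren_up_wk.
Qed.

Lemma wk_app G r s q (t : tm G (s ~> q)) u : wk (r := r) (t @ u) = wk t @ wk u.
Proof. reflexivity. Qed.

(** Both sides obey the same recursion: by [greedy_eq] the value at [k] is exactly the bit that
    [code_S] appends. *)
Lemma bar_greedy G (H : list (fm G)) n T a k :
  eqv H a (greedy n @ T) -> eqv H (bar a k) (code n T k).
Proof.
intro E. apply (prf_cut E).
pose proof (eq_ind_rule (H := eqT a (greedy n @ T) :: H) (a := bar (wk a) v0)
  (b := code (wk n) (wk T) v0) k) as K.
revert K. cbv zeta. rewrite bar_wk, !sub_rec, !sub_code, !sub_scons_wk, !sub_tm_id, !sub_VS_wk.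
rewrite <- !bar_wk. cbn [sub_tm scons v0 Z]. intro K; apply K; clear.
- change (eqv (eqT a (greedy n @ T) :: H) (bar a Z) (code n T Z)).
  now rewrite bar_0, code_0.
- intros H' S E. rewrite bar_S, code_S, E.
  assert (F : eqv H' (wk a) (greedy (wk n) @ wk T)).
  { apply prf_hyp, S. left. rewrite wkf_eqT, wk_app, wk_greedy. reflexivity. }
  now rewrite F, greedy_eq.
Qed.

(** * Standardness *)

Lemma allst_I G (H : list (fm G)) s (A : fm (s :: G)) :
  prf (St v0 :: map wkf H) A -> prf H (all_st A).
Proof. intro P. now apply prf_allI, prf_impI. Qed.

Lemma allst_E G (H : list (fm G)) s (A : fm (s :: G)) t :
  prf H (all_st A) -> prf H (St t) -> prf H (inst A t).
Proof. intro P. exact (prf_impE (prf_allE t P)). Qed.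

Lemma exst_I G (H : list (fm G)) s (A : fm (s :: G)) t :
  prf H (St t) -> prf H (inst A t) -> prf H (ex_st A).
Proof. intros P Q. apply prf_exI with (t := t). now apply prf_andI. Qed.

Lemma ext_ind G (H : list (fm G)) (P : fm (N :: G)) : prf H (inst P Z) ->
  prf (P :: St v0 :: map wkf H) (sub_fm P (scons (Sc v0) (fun s v => Var (VS v)))) ->
  prf H (all_st P).
Proof.
intros P0 PS. eapply prf_mp_ax; [apply DG_ext_ind|]. apply prf_andI; [exact P0|].
now apply allst_I, prf_impI.
Qed.

Lemma st_closed G (H : list (fm G)) s (t : tm [] s) : prf H (St (closed_tm t)).
Proof. apply prf_ax, DG_st_closed. Qed.

Lemma st_app G (H : list (fm G)) r s (f : tm G (r ~> s)) x :
  prf H (St f) -> prf H (St x) -> prf H (St (f @ x)).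
Proof. intro P. exact (prf_impE (prf_mp_ax (DG_st_app _ _) P)). Qed.

Lemma st_Z G (H : list (fm G)) : prf H (St Z).
Proof. exact (st_closed H (Cst cZ)). Qed.

Lemma st_Sc G (H : list (fm G)) x : prf H (St x) -> prf H (St (Sc x)).
Proof. apply st_app. exact (st_closed H (Cst cS)). Qed.

Lemma st_bar G (H : list (fm G)) (b : var G (N ~> N)) n :
  prf H (St (Var b)) -> prf H (St n) -> prf H (St (bar (Var b) n)).
Proof.
intros P Q.
assert (E : eqv H (closed_tm (lam (lam (bar v1 v0))) @ Var b @ n) (bar (Var b) n)).
{ unfold closed_tm. rewrite ren_as_sub, !beta_sub. reflexivity. }
rewrite <- E. apply st_app; [apply st_app|]; try assumption. apply st_closed.
Qed.

Lemma greedy_le G (H : list (fm G)) n T k : prf H (le0 (greedy n @ T @ k) (Sc Z)).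
Proof. apply (le_eq (greedy_eq H n T k) (reflexivity _)), le_bit. Qed.

(** Majorization by the constant functional 1 unfolds to four inequalities: three compare 1 with 1,
    and the other is [greedy_le], valid for every [n], standard or not. *)
Lemma greedy_st G (H : list (fm G)) n : prf H (St (greedy n)).
Proof.
refine (prf_impE (prf_mp_ax (DG_st_maj _ (Cst (cPi _ _) @ one1)) _) _).
{ exact (st_closed H (Cst (cPi _ _) @ (Cst (cPi _ _) @ (Cst cS @ Cst cZ)))). }
assert (E : forall D (K : list (fm D)) (T : tm D (N ~> N)) k,
   eqv K (Cst (cPi (N ~> N) (N ~> N)) @ one1 @ T @ k) (Sc Z)).
{ intros. unfold one1. now rewrite !Pi_eq. }
cbn [maj]. apply prf_allI, prf_allI, prf_impI, prf_andI;
  apply prf_allI, prf_allI, prf_impI, prf_andI.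
- refine (le_eq (reflexivity _) (E _ _ v2 v0) _). rewrite !wk_app, !wk_greedy. apply greedy_le.
- exact (le_eq (E _ _ v2 v1) (E _ _ v2 v0) (le_refl _ _)).
- exact (le_eq (E _ _ v3 v1) (E _ _ v2 v0) (le_refl _ _)).
- exact (le_eq (E _ _ v2 v1) (E _ _ v2 v0) (le_refl _ _)).
Qed.

(* [i < n] is expressed as: [n - i] is a successor. *)
Definition exceeds_st {G} (n : tm G N) : fm G :=
  all_st (monus (wk n) v0 =0 Sc (pred_ (monus (wk n) v0))).

(** Idealization asks only for a number above all [y] up to one given bound, and the successor of
    the bound is one. *)
Lemma exceeds_st_ex G (H : list (fm G)) : prf H (Ex N (exceeds_st v0)).
Proof.
refine (prf_mp_ax (@DG_I G N N (monus v1 v0 =0 Sc (pred_ (monus v1 v0))) I) _).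
apply prf_allI, prf_impI. apply prf_exI with (t := Sc v0). apply prf_allI, prf_impI.
change (eqv (le0 v0 v1 :: map wkf ((St v0 &&& mono v0) :: map wkf H))
  (monus (Sc v1) v0) (Sc (pred_ (monus (Sc v1) v0)))).
unfold eqv. cbn [eqT]. apply (num_case (x := monus (Sc (v1 : tm (N :: N :: G) N)) v0)); intros H' S E.
- apply (le_S_n_n (x := v0)), (le_trans (y := Sc v1)); [|exact E].
  apply le_S, prf_hyp, S. now left.
- exact E.
Qed.

(** [rel] also relativises the sequence and the two lengths quantified inside [init_seg], so [b],
    [i] and [k] must be standard to serve as witnesses. *)
Lemma tree_closed G (H : list (fm G)) (t b : var G (N ~> N)) (i m : var G N) k :
  prf H (rel (binary_tree (Var t))) -> prf H (St (Var b)) -> prf H (St (Var i)) ->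
  prf H (St k) -> prf H (St (Var m)) ->
  eqv H (add_ (Var i) k) (Var m) -> prf H (inT (bar (Var b) (Var m)) (Var t)) ->
  prf H (inT (bar (Var b) (Var i)) (Var t)).
Proof.
intros B Sb Si Sk Sm E P. apply prf_andE2, prf_andE1 in B.
refine (prf_impE (prf_impE (A := rel (init_seg (bar (Var b) (Var i)) (bar (Var b) (Var m)))) _ _) P).
- exact (allst_E (allst_E B (st_bar Sb Si)) (st_bar Sb Sm)).
- apply (exst_I Sb), (exst_I Si), (exst_I Sk), prf_andI.
  + exact (eqT_refl _ (bar (Var b) (Var i))).
  + change (eqv H (bar (Var b) (Var m)) (bar (Var b) (add_ (Var i) k))).
    unfold bar. now rewrite E.
Qed.

(** * The greedy path of an infinite tree *)

Ltac name_hyps K := match goal with |- prf ?L _ => set (K := L) end.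
Tactic Notation "hyp" integer(n) := do n apply prf_cons; apply prf_hyp0.

(** All assumptions are bundled into one formula, so that a single cut takes them into the contexts
    opened by external induction. *)
Definition approx {G} (t b : var G (N ~> N)) (m n : var G N) : fm G :=
  exceeds_st (Var n) &&& rel (binary_tree (Var t)) &&& St (Var b) &&&
  rel (leT (Var b) one1) &&& St (Var m) &&& inT (bar (Var b) (Var m)) (Var t).

Lemma monus_exceeds G (H : list (fm G)) n i :
  prf H (exceeds_st n) -> prf H (St i) ->
  eqv H (monus n i) (Sc (monus n (Sc i))).
Proof.
intros X Y. rewrite monus_S. pose proof (allst_E X Y) as K. revert K. syn. auto.
Qed.

Lemma approx_node G (H : list (fm G)) (t b : var G (N ~> N)) (m n i : var G N) k :
  prf H (approx t b m n) -> prf H (St (Var i)) -> prf H (St k) ->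
  eqv H (add_ (Var i) k) (Var m) -> eqv H (Var t @ bar (Var b) (Var i)) (Sc Z).
Proof.
intros A Si Sk E.
apply (tree_closed (m := m) (k := k)); try assumption.
- eapply prf_andE1, prf_andE2, A.
- eapply prf_andE1, prf_andE2, prf_andE2, A.
- eapply prf_andE1, prf_andE2, prf_andE2, prf_andE2, prf_andE2, A.
- eapply prf_andE2, prf_andE2, prf_andE2, prf_andE2, prf_andE2, A.
Qed.

(** The induction variable [v1] is the distance from the level [v0] up to [m]. The equation between
    them turns the descent from [m] into ordinary external induction. *)
Definition depth_bar_fm {G} (t b : var G (N ~> N)) (m n : var G N) : fm (N :: G) :=
  all_st (add_ v0 v1 =0 Var (VS (VS m)) ==>
    le0 (Sc v1) (depth (Var (VS (VS t))) (monus (Var (VS (VS n))) v0) (bar (Var (VS (VS b))) v0))).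

Lemma sub_allst_imp_I G D (H : list (fm D)) s (A B : fm (s :: G)) (f : sub G D) :
  prf (sub_fm A (up_sub f) :: St v0 :: map wkf H) (sub_fm B (up_sub f)) ->
  prf H (sub_fm (all_st (A ==> B)) f).
Proof. intro P. now apply allst_I, prf_impI. Qed.

Lemma ren_allst_imp_E G D (H : list (fm D)) s (A B : fm (s :: G)) (f : ren G D) t :
  prf H (ren_fm (all_st (A ==> B)) f) -> prf H (St t) ->
  prf H (inst (ren_fm A (up_ren f)) t) -> prf H (inst (ren_fm B (up_ren f)) t).
Proof. intros P Q. exact (prf_impE (allst_E P Q)). Qed.

Lemma inst_ren_le0 G D r (f : ren G (r :: D)) (x y : tm G N) t :
  inst (ren_fm (le0 x y) f) t =
  le0 (sub_tm (scons t (fun s v => Var v)) (ren_tm f x)) (sub_tm (scons t (fun s v => Var v)) (ren_tm f y)).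
Proof. reflexivity. Qed.

Lemma depth_bar G (H : list (fm G)) (t b : var G (N ~> N)) (m n : var G N) :
  prf H (approx t b m n) -> prf H (all_st (depth_bar_fm t b m n)).
Proof.
intro A. apply (prf_cut A). clear A. apply ext_ind; apply sub_allst_imp_I; name_hyps K;
  rewrite sub_le0, sub_depth.
- assert (A : prf K (approx (VS t) (VS b) (VS m) (VS n))) by hyp 2.
  assert (Si : prf K (St v0)) by hyp 1.
  assert (E : eqv K (add_ v0 Z) (Var (VS m))) by hyp 0.
  change (prf K (le0 (Sc Z) (depth (Var (VS t)) (monus (Var (VS n)) v0) (bar (Var (VS b)) v0)))).
  assert (X : eqv K (Var (VS t) @ bar (Var (VS b)) v0) (Sc Z))
    by exact (approx_node A Si (st_Z _) E).
  refine (le_eq (reflexivity _) _ (proj2 (le_S _ _ _) (le_0 _ _))).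
  (* As [n] exceeds the standard level, the cut-off is a successor even at level [m], so a node of
     the tree there has depth at least 1. *)
  rewrite (monus_exceeds (prf_andE1 A) Si). apply depth_node, X.
- assert (A : prf K (approx (VS (VS t)) (VS (VS b)) (VS (VS m)) (VS (VS n)))) by hyp 4.
  assert (Si : prf K (St v0)) by hyp 1.
  assert (Sk : prf K (St v1)) by hyp 3.
  assert (E : eqv K (add_ v0 (Sc v1)) (Var (VS (VS m)))) by hyp 0.
  assert (IH : prf K (wkf (r := N) (depth_bar_fm t b m n))) by hyp 2.
  change (prf K (le0 (Sc (Sc v1)) (depth (Var (VS (VS t))) (monus (Var (VS (VS n))) v0) (bar (Var (VS (VS b))) v0)))).
  assert (L : prf K (le0 (Sc v1) (depth (Var (VS (VS t))) (monus (Var (VS (VS n))) (Sc v0)) (bar (Var (VS (VS b))) (Sc v0))))).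
  { apply (ren_allst_imp_E (t := Sc v0)) in IH; [|exact (st_Sc Si)|].
    - rewrite inst_ren_le0, ren_depth, sub_depth in IH. exact IH.
    - change (eqv K (add_ (Sc v0) v1) (Var (VS (VS m)))). now rewrite add_Sl, <- add_S. }
  apply (le_eq (reflexivity _) (y' := depth (Var (VS (VS t))) (Sc (monus (Var (VS (VS n))) (Sc v0))) (bar (Var (VS (VS b))) v0))).
  { now rewrite <- (monus_exceeds (prf_andE1 A) Si). }
  (* The child taken is the one along [b], whose depth the induction hypothesis [L] bounds from
     below. *)
  apply depth_child with (b := Var (VS (VS b)) @ v0).
  + exact (approx_node A Si (st_Sc Sk) E).
  + apply (le_eq (reflexivity _) (symmetry (Pi_eq K (Sc Z) (v0 : tm (N :: _) N)))).
    exact (allst_E (prf_andE1 (prf_andE2 (prf_andE2 (prf_andE2 A)))) Si).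
  + refine (le_eq (reflexivity _) _ L). now rewrite bar_S.
Qed.

(** The same invariant along the greedy path. Here the induction runs upwards over the number [v1]
    of steps taken, and [v0] counts the levels left before [m]. *)
Definition depth_code_fm {G} (t : var G (N ~> N)) (m n : var G N) : fm (N :: G) :=
  all_st (add_ v1 v0 =0 Var (VS (VS m)) ==>
    le0 (Sc v0) (depth (Var (VS (VS t))) (monus (Var (VS (VS n))) v1)
      (code (Var (VS (VS n))) (Var (VS (VS t))) v1))).

Lemma depth_code G (H : list (fm G)) (t : var G (N ~> N)) (m n : var G N) :
  prf H (le0 (Sc (Var m)) (depth (Var t) (Var n) Z)) -> prf H (all_st (depth_code_fm t m n)).
Proof.
intro A. apply (prf_cut A). clear A. apply ext_ind; apply sub_allst_imp_I; name_hyps K;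
  rewrite sub_le0, sub_depth, sub_code.
- assert (E : eqv K (add_ Z v0) (Var (VS m))) by hyp 0.
  assert (A : prf K (wkf (r := N) (le0 (Sc (Var m)) (depth (Var t) (Var n) Z)))) by hyp 2.
  change (prf K (le0 (Sc (Var (VS m))) (ren_tm shift (depth (Var t) (Var n) Z)))) in A.
  rewrite ren_depth in A.
  change (prf K (le0 (Sc v0) (depth (Var (VS t)) (monus (Var (VS n)) Z) (code (Var (VS n)) (Var (VS t)) Z)))).
  rewrite code_0, monus_0. refine (le_eq _ (reflexivity _) A). now rewrite <- E, add_0l.
- assert (Sk : prf K (St v0)) by hyp 1.
  assert (E : eqv K (add_ (Sc v1) v0) (Var (VS (VS m)))) by hyp 0.
  assert (IH : prf K (wkf (r := N) (depth_code_fm t m n))) by hyp 2.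
  change (prf K (le0 (Sc v0) (depth (Var (VS (VS t))) (monus (Var (VS (VS n))) (Sc v1)) (code (Var (VS (VS n))) (Var (VS (VS t))) (Sc v1))))).
  assert (L : prf K (le0 (Sc (Sc v0)) (depth (Var (VS (VS t))) (monus (Var (VS (VS n))) v1) (code (Var (VS (VS n))) (Var (VS (VS t))) v1)))).
  { apply (ren_allst_imp_E (t := Sc v0)) in IH; [|exact (st_Sc Sk)|].
    - rewrite inst_ren_le0, ren_depth, ren_code, sub_depth, sub_code in IH. exact IH.
    - change (eqv K (add_ v1 (Sc v0)) (Var (VS (VS m)))). now rewrite add_S, <- add_Sl. }
  apply depth_pos, proj2 in L. refine (le_eq (reflexivity _) _ L).
  now rewrite code_S, monus_S.
Qed.

Lemma sub_allst_imp_E G D (H : list (fm D)) s (A B : fm (s :: G)) (f : sub G D) t :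
  prf H (sub_fm (all_st (A ==> B)) f) -> prf H (St t) ->
  prf H (inst (sub_fm A (up_sub f)) t) -> prf H (inst (sub_fm B (up_sub f)) t).
Proof. intros P Q. exact (prf_impE (allst_E P Q)). Qed.

Lemma inst_sub_le0 G D r (f : sub G (r :: D)) (x y : tm G N) t :
  inst (sub_fm (le0 x y) f) t =
  le0 (sub_tm (scons t (fun s v => Var v)) (sub_tm f x)) (sub_tm (scons t (fun s v => Var v)) (sub_tm f y)).
Proof. reflexivity. Qed.

Lemma depth_root G (H : list (fm G)) (t b : var G (N ~> N)) (m n : var G N) :
  prf H (approx t b m n) -> prf H (le0 (Sc (Var m)) (depth (Var t) (Var n) Z)).
Proof.
intro A.
assert (Sm : prf H (St (Var m)))
  by exact (prf_andE1 (prf_andE2 (prf_andE2 (prf_andE2 (prf_andE2 A))))).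
(* Distance [m] and level 0, that is, the empty sequence. *)
pose proof (allst_E (depth_bar A) Sm) as P. unfold inst, depth_bar_fm in P.
apply sub_allst_imp_E with (t := Z) in P; [|apply st_Z|exact (add_0l H (Var m))].
rewrite inst_sub_le0, !sub_depth in P.
change (prf H (le0 (Sc (Var m)) (depth (Var t) (monus (Var n) Z) (bar (Var b) Z)))) in P.
now rewrite monus_0, bar_0 in P.
Qed.

Lemma approx_code G (H : list (fm G)) (t b : var G (N ~> N)) (m n : var G N) :
  prf H (approx t b m n) -> eqv H (Var t @ code (Var n) (Var t) (Var m)) (Sc Z).
Proof.
intro A.
assert (Sm : prf H (St (Var m)))
  by exact (prf_andE1 (prf_andE2 (prf_andE2 (prf_andE2 (prf_andE2 A))))).
(* After [m] steps with no level left the depth is still at least 1, which by [depth_pos] places the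
   node in the tree. *)
pose proof (allst_E (depth_code (depth_root A)) Sm) as P. unfold inst, depth_code_fm in P.
apply sub_allst_imp_E with (t := Z) in P; [|apply st_Z|exact (add_0 H (Var m))].
rewrite inst_sub_le0, !sub_depth, !sub_code in P.
apply (depth_pos (n := monus (Var n) (Var m)) (k := Z)). exact P.
Qed.

(** The sequence [b] obtained from infinity of the tree varies with [m], but it disappears from the
    conclusion: the greedy node depends on [n] and the tree alone. *)
Lemma tree_code G (H : list (fm G)) (t : var G (N ~> N)) (n m : var G N) :
  prf H (exceeds_st (Var n)) -> prf H (rel (binary_tree (Var t))) ->
  prf H (rel (infinite (Var t))) -> prf H (St (Var m)) ->
  eqv H (Var t @ code (Var n) (Var t) (Var m)) (Sc Z).
Proof.
intros X B I Sm.
assert (P : prf H (exceeds_st (Var n) &&& rel (binary_tree (Var t)) &&& St (Var m)))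
  by auto using prf_andI.
apply (prf_cut P). clear X B P.
refine (prf_exE (allst_E (prf_cons _ I) (prf_cons _ Sm)) _).
name_hyps K.
assert (P : prf K (exceeds_st (Var (VS n)) &&& rel (binary_tree (Var (VS t))) &&& St (Var (VS m)))) by hyp 1.
assert (Q : prf K (St v0 &&& rel (leT v0 one1) &&& inT (bar v0 (Var (VS m))) (Var (VS t)))) by hyp 0.
assert (A : prf K (approx (VS t) VZ (VS m) (VS n))).
{ exact (prf_andI (prf_andE1 P) (prf_andI (prf_andE1 (prf_andE2 P))
    (prf_andI (prf_andE1 Q) (prf_andI (prf_andE1 (prf_andE2 Q))
      (prf_andI (prf_andE2 (prf_andE2 P)) (prf_andE2 (prf_andE2 Q))))))). }
change (prf K (Var (VS t) @ ren_tm shift (code (Var n) (Var t) (Var m)) =0 Sc Z)).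
rewrite ren_code. exact (approx_code A).
Qed.

Lemma tree_path G (H : list (fm G)) (t : var G (N ~> N)) (n m : var G N) a :
  prf H (exceeds_st (Var n)) -> prf H (rel (binary_tree (Var t))) ->
  prf H (rel (infinite (Var t))) -> prf H (St (Var m)) ->
  eqv H a (greedy (Var n) @ Var t) -> prf H (inT (bar a (Var m)) (Var t)).
Proof.
intros X B I Sm E. change (eqv H (Var t @ bar a (Var m)) (Sc Z)).
rewrite (bar_greedy (Var m) E). now apply tree_code.
Qed.

(** * The two relativised principles *)

Lemma UWKL_st : DG_proves (rel UWKL).
Proof.
refine (prf_exE (exceeds_st_ex []) _).
apply (prf_name (t := greedy v0)).
name_hyps K.
assert (E : eqv K v0 (greedy v1)).
{ apply prf_hyp. left. now rewrite wk_greedy. }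
refine (exst_I (t := v0) _ _); [rewrite E; apply greedy_st|].
apply allst_I, prf_impI, prf_impI, allst_I. name_hyps L.
(* From [v0] to [v3] the context holds the length, the tree, the named functional and the
   nonstandard number. *)
apply (@tree_path _ L (VS VZ) (VS (VS (VS VZ))) VZ (v2 @ v1)).
- hyp 5.
- hyp 2.
- hyp 1.
- hyp 0.
- apply eqT_app1. apply prf_hyp. do 4 right. left.
  rewrite !wkf_eqT, !wk_greedy. reflexivity.
Qed.

(** [UWKL] does not state that its path is bounded by 1, so the greedy sequence is used afresh, with
    [greedy_le] giving the bound. *)
Lemma WKL_st : DG_proves (rel WKL).
Proof.
apply allst_I, prf_impI, prf_impI.
refine (prf_exE (exceeds_st_ex _) _).
apply (prf_name (t := greedy v0 @ v1)).
name_hyps K.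
assert (E : eqv K v0 (greedy v1 @ v2)).
{ apply prf_hyp. left. now rewrite wk_app, wk_greedy. }
refine (exst_I (t := v0) _ _); [|apply prf_andI].
- rewrite E. apply st_app; [apply greedy_st|hyp 4].
- apply allst_I. name_hyps L.
  assert (F : eqv L v1 (greedy v2 @ v3)).
  { apply prf_cons, prf_hyp. left. now rewrite wkf_eqT, !wk_app, !wk_greedy. }
  refine (le_eq (eqT_app1 v0 F) (Pi_eq L (Sc Z) v0) _). apply greedy_le.
- apply allst_I. name_hyps L.
  (* Here the context holds, from [v0] to [v3], the length, the named path, the nonstandard number
     and the tree. *)
  apply (@tree_path _ L (VS (VS (VS VZ))) (VS (VS VZ)) VZ v1).
  + hyp 2.
  + hyp 4.
  + hyp 3.
  + hyp 0.
  + apply prf_cons, prf_hyp. left. now rewrite wkf_eqT, !wk_app, !wk_greedy.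
Qed.

Theorem theorem3p17 : DG_proves (rel WKL) /\ DG_proves (rel UWKL).
Proof. exact (conj WKL_st UWKL_st). Qed.
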